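(* Let $(T,\prec)$ be a countable tree of height $\le\omega$, presented as a partial ordering. Then $(T,\prec)$ is weakly ultrahomogeneous if and only if the set of elements of $T$ which have rank $\ge 1$ is finite.
   Context: A tree $(T,\prec)$ is a partially ordered set with least element $\epsilon$ (the root) such that for every $a\in T$ the set $\{x:x\prec a\}$ is well-ordered by $\prec$; height $\le\omega$ here means that $\{x:x\prec a\}$ is finite for every $a\in T$. The rank of $x\in T$ is defined recursively by $rk_T(x)=\sup\{rk_T(y)+1: x\prec y\}$, with $rk_T(x)=\infty$ if $x$ lies on an infinite path through $T$; thus $rk_T(x)=0$ exactly when $x$ is a leaf (has no element above it), and rank $\ge1$ means $x$ is not a leaf. $(T,\prec)$ is weakly ultrahomogeneous if there is a finite set $\{a_1,\dots,a_n\}\subseteq T$ such that every isomorphism, with respect to $\prec$, between finite substructures (finite subsets with the induced order) containing all $a_i$ and fixing each $a_i$ extends to an automorphism of $(T,\prec)$. *)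

(* Defs.v *)
From HB Require Import structures.
From mathcomp Require Import all_boot all_order.
From mathcomp Require Import boolp classical_sets functions cardinality wochoice.
Set Implicit Arguments.
Unset Strict Implicit.
Unset Printing Implicit Defensive.
Import Order.TTheory.
Local Open Scope classical_set_scope.
Local Open Scope order_scope.

(* [OSup f] denotes the ordinal sup {f i + 1 : i in K}; every ordinal has this
   form, and distinct terms may denote the same ordinal. *)
Inductive ord : Type := OSup (K : Type) (f : K -> ord).

(* sup_i (f i + 1) <= sup_j (g j + 1) iff every f i is below some g j. *)
Fixpoint ole (a b : ord) : Prop :=
  match a, b with
  | OSup K f, OSup L g => forall i : K, exists j : L, ole (f i) (g j)
  end.

Definition ozero : ord := OSup (fun e : Empty_set => match e with end).
Definition osucc (a : ord) : ord := OSup (fun _ : unit => a).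
Definition oone : ord := osucc ozero.

Inductive xord : Type := XFin of ord | XInfty.

Definition xle (a b : xord) : Prop :=
  match a, b with
  | XFin a, XFin b => ole a b
  | _, XInfty => True
  | XInfty, XFin _ => False
  end.

Section Trees.
Context {d : Order.disp_t}.

(* The root is the least element [\bot] provided by the type. *)
Definition is_tree (T : bPOrderType d) : Prop :=
  forall a : T, wo_chain <=%O (fun x : T => x < a).

Definition height_le_omega (T : bPOrderType d) : Prop :=
  forall a : T, finite_set [set x : T | x < a].

Variable T : bPOrderType d.
Implicit Types x y z : T.

Definition is_path (P : set T) : Prop :=
  total_on P <=%O /\ (forall x y, P y -> x <= y -> P x).

Definition on_infinite_path x : Prop :=
  exists P : set T, [/\ is_path P, infinite_set P & P x].

Fixpoint rank_acc x (h : Acc (fun z y => y < z) x) : ord :=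
  OSup (fun y : {y | x < y} => rank_acc (Acc_inv h (proj2_sig y))).

Lemma acc_of_no_infinite_path x :
  is_tree T -> ~ on_infinite_path x -> Acc (fun z y => y < z) x.
Proof.
move=> hT; apply: contra_notP => nx.
pose S := {y : T | ~ Acc (fun z y => y < z) y}.
have step (s : S) : {t : S | sval s < sval t}.
  apply: cid; case: s => y ny /=; apply: contrapT => nt; apply: ny.
  apply: Acc_intro => z yz; apply: contrapT => nz.
  by apply: nt; exists (exist _ z nz).
pose u n := sval (iter n (fun s => sval (step s)) (exist _ x nx : S)).
have uS n : u n < u n.+1 by rewrite /u iterS; case: (step _).
have u_mono : {homo u : m n / (m < n)%N >-> m < n}.
  by apply: homo_ltn uS => ? ? ?; exact: lt_trans.
have u_le m n : (m <= n)%N -> u m <= u n.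
  by rewrite leq_eqVlt => /predU1P[->//|/u_mono /ltW].
exists [set y | exists n, y <= u n]; split; last by exists 0%N.
- split=> [y z [m ym] [n zn]|y z [n zn] yz]; last by exists n; exact: le_trans zn.
  have tot := wo_chainW (hT (u (maxn m n).+1)).
  apply/orP/tot; rewrite unfold_in.
  + by apply: le_lt_trans ym _; apply: u_mono; rewrite ltnS leq_maxl.
  + by apply: le_lt_trans zn _; apply: u_mono; rewrite ltnS leq_maxr.
- apply: (@sub_infinite_set _ (u @` setT)) => [_ [n _ <-]|]; first by exists n.
  have u_inj : {in [set: nat] &, injective u}.
    move=> m n _ _ umn; apply/eqP; case: ltngtP => // /u_mono.
      by rewrite umn ltxx.
    by rewrite umn ltxx.
  by rewrite (eq_finite_set (inj_card_eq u_inj)); exact: infinite_nat.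
Qed.

(* If [x] lies on no infinite path then neither does any [y] above [x], so the
   supremum over the ranks of such [y] is a supremum of ordinals. *)
Definition rank (hT : is_tree T) x : xord :=
  match pselect (on_infinite_path x) with
  | left _ => XInfty
  | right h => XFin (rank_acc (acc_of_no_infinite_path hT h))
  end.

Definition is_automorphism (g : T -> T) : Prop :=
  bijective g /\ {mono g : x y / x < y}.

(* An isomorphism between the substructures with domains [A] and [B] is given
   by a map of [T], of which only the values on [A] matter. *)
Definition is_isomorphism_between (A B : set T) (f : T -> T) : Prop :=
  set_bij A B f /\ {in A &, {mono f : x y / x < y}}.

Definition weakly_ultrahomogeneous : Prop :=
  exists S : set T, finite_set S /\
    forall (A B : set T) (f : T -> T),
      finite_set A -> finite_set B -> S `<=` A -> S `<=` B ->
      is_isomorphism_between A B f -> (forall a, S a -> f a = a) ->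
      exists g : T -> T, is_automorphism g /\ forall x, A x -> g x = f x.

End Trees.

Arguments weakly_ultrahomogeneous {d} T.

(* Main.v *)
Require Import Defs.
From mathcomp Require Import all_boot all_order.
From mathcomp Require Import boolp classical_sets functions cardinality wochoice.
Local Open Scope classical_set_scope.

(** Write [N] for the set of elements that are not leaves; these are exactly
    the elements of rank at least [1] ([rank_ge1P]).

    Suppose that a finite set [S] witnesses weak ultrahomogeneity but [N] is
    infinite. The downward closure of [S] is finite, so some [x] in [N] lies
    outside it; let [x < y]. An element of [S] below [y] is comparable with
    [x], hence below [x], and no element of [S] is above [x]; so [x] and [y]
    are in the same position relative to [S], and sending [x] to [y] while
    fixing [S] is an isomorphism of finite substructures
    ([nonleaf_same_position]). It does not extend, because no automorphism
    moves an element strictly up: it preserves the finite number of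
    predecessors ([automorphism_not_lt]).

    Conversely, if [N] is finite then [N] itself is a witness. An isomorphism
    fixing [N] sends each leaf to a leaf with the same predecessors, as all
    predecessors of a leaf are in [N]. Exchanging two such leaves is an
    automorphism, so an extension can be assembled from finitely many
    transpositions, one for each point of the domain
    ([extension_by_twins]). *)

Import Order.TTheory.
Local Open Scope order_scope.

Section Proof.
Set Implicit Arguments.
Unset Strict Implicit.
Context {d : Order.disp_t} {T : bPOrderType d}.
Implicit Types (x y z u v : T) (A B S : set T) (f g : T -> T).

(** * Rank and leaves *)

Definition nonleaf : set T := [set x | exists y, x < y].

(** On an infinite path the rank carries no witness, but the path cannot stay
    among the finitely many elements [<= x]. *)
Lemma rank_ge1P (hT : is_tree T) x : height_le_omega T ->
  xle (XFin oone) (rank hT x) <-> nonleaf x.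
Proof.
move=> hh; rewrite /rank; case: pselect => [[P [[Ptot _] Pinf Px]]|h].
  split=> // _; apply: contrapT => leafx; apply: Pinf.
  apply: (@sub_finite_set _ _ ([set z | z < x] `|` [set x])); last first.
    by rewrite finite_setU; split; [exact: hh | exact: finite_set1].
  move=> z Pz; case: (Ptot z x Pz Px); rewrite le_eqVlt.
    by move=> /predU1P[->|]; [right|left].
  move=> /predU1P[<-|xz]; first by right.
  by case: leafx; exists z.
rewrite /=; case: (acc_of_no_infinite_path _ _) => r /=; split.
  by move=> /(_ tt)[[y xy] _]; exists y.
by move=> [y xy] _; exists (exist _ y xy) => /=; case: (rank_acc _) => K k [].
Qed.

(** * Infinitely many nonleaves preclude weak ultrahomogeneity *)

(** The inverse of [g] would inject the finite set of predecessors of [g x]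
    into its subset of predecessors of [x], hence onto itself, although that
    subset misses [x]. *)
Lemma automorphism_not_lt g x :
  height_le_omega T -> is_automorphism g -> ~ x < g x.
Proof.
move=> hh [[h gK hK] gmono] xgx.
have /finite_seqP[s0 Es0] := hh (g x); pose s := undup s0.
have mem_s z : (z \in s) = (z < g x).
  rewrite mem_undup; apply/idP/idP => [zs|zgx].
    by have : [set` s0] z by []; rewrite -Es0.
  by have : [set z | z < g x] z by []; rewrite Es0.
have h_lt z : z < g x -> h z < x by rewrite -{1}(hK z) gmono.
have hs_sub : {subset map h s <= s}.
  move=> _ /mapP[z zs ->]; rewrite mem_s; apply: lt_trans xgx.
  by apply: h_lt; rewrite -mem_s.
have hs_uniq : uniq (map h s).
  by rewrite map_inj_uniq ?undup_uniq //; exact: can_inj hK.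
have [|_ hsE] := uniq_min_size hs_uniq hs_sub; first by rewrite size_map.
have : x \in map h s by rewrite hsE mem_s.
by move=> /mapP[z]; rewrite mem_s => /h_lt + xhz; rewrite -xhz ltxx.
Qed.

Lemma finite_downward_closure S : height_le_omega T -> finite_set S ->
  finite_set [set x | exists2 s, S s & x <= s].
Proof.
move=> hh finS.
have -> : [set x | exists2 s, S s & x <= s] =
          \bigcup_(s in S) ([set x | x < s] `|` [set s]).
  apply/seteqP; split=> x /= [s Ss].
    by rewrite le_eqVlt => /predU1P[->|]; exists s => //; [right|left].
  by case=> [xs|->]; exists s => //; exact: ltW.
apply: bigcup_finite => // s _.
by rewrite finite_setU; split; [exact: hh | exact: finite_set1].
Qed.

(** If the nonleaves are too numerous to lie all below [S], a nonleaf [x]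
    outside the downward closure of [S] and any [y] above it will do: an
    element of [S] below [y] is comparable with [x], so it is below [x]. *)
Lemma nonleaf_same_position S : is_tree T -> height_le_omega T ->
  finite_set S -> infinite_set nonleaf ->
  exists x y, [/\ x < y, ~ S x, ~ S y &
    forall s, S s -> [/\ (s < x) = (s < y), ~~ (x < s) & ~~ (y < s)]].
Proof.
move=> hT hh finS infN.
have [x [[y xy] xS]] : exists x, nonleaf x /\ ~ exists2 s, S s & x <= s.
  apply: contrapT => noN; apply: infN.
  apply: (sub_finite_set _ (finite_downward_closure hh finS)) => x Nx.
  by apply: contrapT => nx; apply: noN; exists x.
have xleS s : S s -> ~~ (x <= s) by move=> Ss; apply/negP => xs; apply: xS; exists s.
exists x, y; split=> // [Sx|Sy|s Ss].
- by have := xleS _ Sx; rewrite lexx.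
- by have := xleS _ Sy; rewrite (ltW xy).
- have nxs := xleS _ Ss; split.
  + apply/idP/idP => [sx|sy]; first exact: lt_trans xy.
    have /(_ s x sy xy) := wo_chainW (hT y); rewrite (negPf nxs) orbF le_eqVlt.
    by move=> /predU1P[sx|//]; rewrite sx lexx in nxs.
  + by apply: contra nxs; exact: ltW.
  + by apply: contra nxs => ys; exact: ltW (lt_trans xy ys).
Qed.

Lemma finite_nonleaf_of_wuh : is_tree T -> height_le_omega T ->
  weakly_ultrahomogeneous T -> finite_set nonleaf.
Proof.
move=> hT hh [S [finS ext]]; apply: contrapT => infN.
have [x [y [xy nSx nSy pos]]] := nonleaf_same_position hT hh finS infN.
pose f z := if z == x then y else z.
have fx : f x = y by rewrite /f eqxx.
have fS s : S s -> f s = s.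
  by move=> Ss; rewrite /f; case: eqP => // sx; case: nSx; rewrite -sx.
have [||||||g [gaut gf]] := ext (x |` S) (y |` S) f.
- by rewrite finite_setU; split.
- by rewrite finite_setU; split.
- exact: subsetUr.
- exact: subsetUr.
- split; [split|].
  + by move=> z [->|Sz]; rewrite /= ?fx ?fS//; [left|right].
  + move=> u v; rewrite !inE => -[->|Su] [->|Sv]; rewrite ?fx ?fS // => E.
      by case: nSy; rewrite E.
    by case: nSy; rewrite -E.
  + move=> z [->|Sz]; first by exists x => //; left.
    by exists z; [right | exact: fS].
  + move=> u v; rewrite !inE => -[->|Su] [->|Sv]; rewrite ?fx ?fS ?ltxx //.
      by have [_ /negPf-> /negPf->] := pos _ Sv.
    by have [->] := pos _ Su.
- exact: fS.
- apply: (automorphism_not_lt (x := x) hh gaut).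
  by rewrite gf ?fx //; left.
Qed.

(** * Extending isomorphisms when there are finitely many nonleaves *)

(** Every bijection moving each point to one of its twins is an automorphism,
    see [twins_lt]: nonleaves are twins only of themselves, and leaves are
    twins when they have the same predecessors. *)
Definition twins u v :=
  (forall z, (z < u) = (z < v)) /\ (nonleaf u \/ nonleaf v -> u = v).

Lemma twins_refl u : twins u u. Proof. by split. Qed.

Lemma twins_sym u v : twins u v -> twins v u.
Proof.
by move=> [uv Nuv]; split=> [z|Nvu]; [rewrite uv | rewrite Nuv //; case: Nvu; auto].
Qed.

Lemma twins_trans u v w : twins u v -> twins v w -> twins u w.
Proof.
move=> [uv Nuv] [vw Nvw]; split=> [z|[Nu|Nw]]; first by rewrite uv.
  have Euv := Nuv (or_introl Nu).
  by rewrite Euv; apply: Nvw; left; rewrite -Euv.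
have Evw := Nvw (or_intror Nw).
by rewrite -Evw; apply: Nuv; right; rewrite Evw.
Qed.

Lemma twins_lt x x' y y' : twins x x' -> twins y y' -> (x' < y') = (x < y).
Proof.
move=> [_ Nx] [yy' _]; rewrite -yy'; apply/idP/idP => xy.
  by rewrite Nx //; right; exists y.
by rewrite -Nx //; left; exists y.
Qed.

Definition transpose u v x := if x == u then v else if x == v then u else x.

Lemma transposeK u v : involutive (transpose u v).
Proof.
move=> x; rewrite /transpose.
have [->|xu] := eqVneq x u; first by rewrite eqxx; case: eqP.
have [->|xv] := eqVneq x v; first by rewrite eqxx.
by rewrite (negPf xu) (negPf xv).
Qed.

Lemma twins_transpose u v x : twins u v -> twins x (transpose u v x).
Proof.
move=> uv; rewrite /transpose; case: eqP => [->//|_].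
by case: eqP => [->|_]; [exact: twins_sym | exact: twins_refl].
Qed.

(** Points are treated one at a time: if [g] agrees with [f] on [s], then
    following [g] by the exchange of [f a] and [g a] corrects the value at [a]
    and, by injectivity, spoils no value on [s]. *)
Lemma extension_by_twins (s : seq T) f :
  {in s &, injective f} -> (forall x, x \in s -> twins x (f x)) ->
  exists g, [/\ bijective g, forall x, twins x (g x) & {in s, g =1 f}].
Proof.
elim: s => [|a s IHs] finj ftw.
  by exists id; split=> //; exists id.
have [||g [gbij gtw gf]] := IHs.
- by move=> x y xs ys; apply: finj; rewrite inE ?xs ?ys orbT.
- by move=> x xs; apply: ftw; rewrite inE xs orbT.
have fga : twins (f a) (g a).
  by apply: twins_trans (gtw a); apply/twins_sym/ftw; rewrite mem_head.
exists (transpose (f a) (g a) \o g); split.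
- by apply: bij_comp gbij; exists (transpose (f a) (g a)); exact: transposeK.
- by move=> x; apply: twins_trans (gtw x) _; exact: twins_transpose.
- move=> x; have [->|xa] := eqVneq x a => xas /=.
    by rewrite /transpose eqxx; case: eqP.
  have xs : x \in s by move: xas; rewrite inE (negPf xa).
  rewrite /transpose (inj_eq (bij_inj gbij)) (negPf xa) gf //.
  by case: eqP => // /(finj _ _ xas (mem_head _ _))/eqP; rewrite (negPf xa).
Qed.

(** A predecessor of a leaf is a nonleaf, so it belongs to the substructure and
    is fixed: the order relations with nonleaves make [x] and [f x] twins. *)
Lemma twins_of_isomorphism A B f : nonleaf `<=` A ->
  is_isomorphism_between A B f -> (forall a, nonleaf a -> f a = a) ->
  forall x, A x -> twins x (f x).
Proof.
move=> NA [[_ finj _] fmono] fN x Ax; split=> [z|].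
  have below : nonleaf z -> (z < x) = (z < f x).
    by move=> Nz; rewrite -{2}(fN z Nz) fmono ?inE //; exact: NA.
  by apply/idP/idP => zx; [rewrite -below | rewrite below] => //; eexists; exact: zx.
case=> [/fN //|Nfx].
by apply: finj; rewrite ?inE //; [exact: NA | rewrite (fN _ Nfx)].
Qed.

Lemma wuh_of_finite_nonleaf : finite_set nonleaf -> weakly_ultrahomogeneous T.
Proof.
move=> finN; exists nonleaf; split=> // A B f finA _ NA _ isof fN.
have tw := twins_of_isomorphism NA isof fN.
have [s As] := (finite_seqP A).1 finA; subst A.
have [||g [gbij gtw gf]] := @extension_by_twins s f.
- by case: isof => -[_ finj _] _ x y xs ys; apply: finj; rewrite inE.
- exact: tw.
- by exists g; split=> //; split=> // x y; exact: twins_lt.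
Qed.

End Proof.

Theorem proposition7p4 (d : Order.disp_t) (T : bPOrderType d)
    (hcount : countable [set: T])
    (htree : is_tree T)
    (hheight : height_le_omega T) :
  weakly_ultrahomogeneous T <->
  finite_set [set x : T | xle (XFin oone) (rank htree x)].
Proof.
have -> : [set x : T | xle (XFin oone) (rank htree x)] = nonleaf.
  by apply/seteqP; split=> x /(rank_ge1P htree _ hheight).
split; [exact: finite_nonleaf_of_wuh | exact: wuh_of_finite_nonleaf].
Qed.
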